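(* Let $G$ be a countable group which is not finitely generated, let $A$ be a finite alphabet, and let $X\subseteq A^G$ be a subshift. Then $X$ is projectively isolated in the space $\mathcal{S}(A^G)$ of all subshifts if and only if $X$ is minimal and sofic.
   Context: For a finite (non-empty) alphabet $A$, $G$ acts on $A^G$ by $(g\cdot x)(h)=x(g^{-1}h)$. A subshift is a non-empty closed $G$-invariant subset of $A^G$; it is minimal if it has no proper non-empty closed $G$-invariant subset. $\mathcal{S}(A^G)$ is the space of all subshifts of $A^G$ with the Vietoris topology. A pattern is a function $p\colon F\to A$ with $F\subseteq G$ finite, and $C_p=\{x\in A^G:x|_F=p\}$. A subshift is of finite type (an SFT) if it is of the form $A^G\setminus\bigcup_{p\in P}\bigcup_{g\in G}g\cdot C_p$ for a finite set $P$ of patterns. A factor map is a continuous $G$-equivariant surjection. A subshift $X\subseteq A^G$ is sofic if there are a finite alphabet $B$, an SFT $Y\subseteq B^G$ and a factor map $Y\to X$. A subshift $X\in\mathcal{S}(A^G)$ is projectively isolated in $\mathcal{S}(A^G)$ if there exist a finite alphabet $B$, a factor map $\Phi\colon B^G\to A^G$, and a non-empty open subset $\mathcal{U}\subseteq\mathcal{S}(B^G)$ such that $\Phi[Y]=X$ for every $Y\in\mathcal{U}$. *)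

(* Defs.v *)
From HB Require Import structures.
From mathcomp Require Import all_boot finmap.
From mathcomp Require Import all_classical topology.

Set Implicit Arguments.
Unset Strict Implicit.
Unset Printing Implicit Defensive.

Local Open Scope classical_set_scope.

(* A^G, with A discrete and the product topology. *)
Notation full_shift G A := {ptws G -> discrete_topology A}.

Definition finitely_generated (G : groupType) : Prop :=
  exists2 S : set G, finite_set S &
    smallest (fun H : set G => group_closed (fun x => x \in H)) S = [set: G].

Section Shifts.
Variables (G : groupType) (A : finType).
Implicit Types X Y : set (full_shift G A).

Definition shift_act (g : G) (x : full_shift G A) : full_shift G A :=
  fun h => x (g^-1 * h)%g.

Definition shift_invariant X : Prop := forall g, shift_act g @` X `<=` X.

Definition is_subshift X : Prop :=
  [/\ X !=set0, closed X & shift_invariant X].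

Definition is_minimal X : Prop :=
  is_subshift X /\
  forall Y, Y `<=` X -> Y !=set0 -> closed Y -> shift_invariant Y -> Y = X.

(* A pattern F -> A with F a finite subset of G is a finite map p, whose
   domain F is domf p. *)
Definition cylinder (p : {fmap G -> A}) : set (full_shift G A) :=
  [set x | forall h : domf p, x (val h) = p h].

Definition is_sft X : Prop :=
  is_subshift X /\
  exists2 P : set {fmap G -> A}, finite_set P &
    X = ~` (\bigcup_(p in P) \bigcup_(g in [set: G]) (shift_act g @` cylinder p)).

Record subshift : Type := Subshift {
  subshift_set :> set (full_shift G A);
  subshiftP : is_subshift subshift_set
}.

HB.instance Definition _ := gen_eqMixin subshift.
HB.instance Definition _ := gen_choiceMixin subshift.

(* The subbase of the Vietoris topology: for U open in A^G, the subshifts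
   contained in U (index (true, U)) and those meeting U (index (false, U)). *)
Definition vietoris_subbase (i : bool * set (full_shift G A)) : set subshift :=
  if i.1 then [set X : subshift | X `<=` i.2]
  else [set X : subshift | X `&` i.2 !=set0].

HB.instance Definition _ :=
  isSubBaseTopological.Build subshift [set i | open i.2] vietoris_subbase.

End Shifts.

(* A map defined on Y is represented by a total function, of which only the
   restriction to Y matters. *)
Definition factor_map (G : groupType) (B A : finType)
    (Y : set (full_shift G B)) (X : set (full_shift G A))
    (f : full_shift G B -> full_shift G A) : Prop :=
  [/\ {within Y, continuous f},
      forall g y, Y y -> f (shift_act g y) = shift_act g (f y) &
      f @` Y = X].

Definition is_sofic (G : groupType) (A : finType)
    (X : set (full_shift G A)) : Prop :=
  is_subshift X /\
  exists (B : finType) (Y : set (full_shift G B))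
         (f : full_shift G B -> full_shift G A),
    [/\ (0 < #|B|)%N, is_sft Y & factor_map Y X f].

Definition projectively_isolated (G : groupType) (A : finType)
    (X : subshift G A) : Prop :=
  exists (B : finType) (Phi : full_shift G B -> full_shift G A)
         (U : set (subshift G B)),
    [/\ (0 < #|B|)%N,
        factor_map [set: full_shift G B] [set: full_shift G A] Phi,
        open U, U !=set0 &
        forall Y : subshift G B, U Y -> Phi @` Y = X].

(* Main.v *)
Require Import Defs.
From mathcomp Require Import all_boot finmap.
From mathcomp Require Import all_classical topology.

(** A configuration is only ever inspected through finite windows F of G, and
    compactness makes every topological notion in play finitary: factor maps are
    block codes ([factor_map_block_code]), and a Vietoris neighbourhood of a
    subshift Y contains all subshifts having the same F-patterns as Y for some
    finite F ([vietoris_window]).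

    Suppose that Phi maps every member of an open set U onto X, and let Y be in
    U, with such a window F. The SFT [sft_hull F Y] of all configurations whose
    F-patterns occur in Y has the same F-patterns as Y, so it lies in U and Phi
    maps it onto X: X is sofic. For minimality, take a subgroup H containing F.
    Every translate of F lies in one left coset of H, so configurations of the
    hull can be changed independently on H and off H ([splice_sft_hull]). As G
    is not finitely generated, H can be chosen proper and large enough to contain
    any prescribed finite set. Hence the hull has a point z seeing all
    F-patterns of Y within a finite set ([sft_hull_universal_point]). Given a
    point x = Phi y of a subsystem of X and a pattern of X on a finite set K,
    let z1 be z on H and y off H, for H large. The orbit closure of z1 still
    maps onto X. Some point of X shows the pattern in two different cosets of H,
    so Phi z1 does too, up to translation; one of the two occurrences is then
    off H, where Phi z1 agrees with x. So every pattern of X occurs in x, and x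
    has dense orbit in X ([isolated_minimal]).

    Conversely, let f map an SFT Y over an alphabet C onto a minimal X. The map f
    extends to a factor map from the full shift over the disjoint union of C
    and A onto the full shift over A ([factor_extension]). The subshifts of the
    copy of Y form an open set, as only finitely many patterns are forbidden
    ([embed_left_window]); each of them is mapped onto a subsystem of X, that
    is, onto X by minimality ([minimal_sft_factor_isolated]). *)

Set Implicit Arguments.
Unset Strict Implicit.
Unset Printing Implicit Defensive.

Local Open Scope classical_set_scope.

(** * Windows and compactness of the full shift *)

Section FullShift.
Variables (G : groupType) (A : finType).
Implicit Types (x y z : full_shift G A) (Y : set (full_shift G A)).

(** Over a discrete alphabet the product topology has the cylinders as basic
    neighbourhoods. *)
Lemma nbhs_windowP x (U : set (full_shift G A)) :
  nbhs x U <->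
  exists F : {fset G}, forall z, {in F, z =1 x} -> U z.
Proof.
split=> [xU|[F FU]].
  pose W (F : {fset G}) : set (full_shift G A) :=
    [set z : full_shift G A | {in F, z =1 x}].
  have Wfilter : Filter (filter_from [set: {fset G}] W).
    apply: filter_from_filter; first by exists fset0.
    move=> F1 F2 _ _; exists (F1 `|` F2)%fset => // z zx.
    by split=> h hF; apply: zx; rewrite in_fsetE hF ?orbT.
  have Wx : filter_from setT W --> x.
    apply/cvg_sup => g V [V'] [[S _ <-] Sx sV].
    exists [fset g]%fset => // z zx; apply: sV.
    by rewrite /preimage /= zx // in_fset1.
  by have [F _ sU] := Wx _ xU; exists F.
apply: (@filterS _ _ _
  (\bigcap_(h in [set` F]) [set z : full_shift G A | z h = x h])).
  by move=> z zx; apply: FU => h /zx.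
apply: filter_bigI => h _.
apply: (@proj_continuous G (fun=> discrete_topology A) h x [set a | a = x h]).
by rewrite nbhs_principalE; apply/principal_filterP.
Qed.

Lemma nbhs_window x (F : {fset G}) :
  nbhs x [set z : full_shift G A | {in F, z =1 x}].
Proof. by apply/nbhs_windowP; exists F. Qed.

Lemma closed_windowP Y :
  closed Y <->
  forall x, (forall F : {fset G}, exists2 y, Y y & {in F, y =1 x}) -> Y x.
Proof.
split=> clY x.
  move=> Yx; apply: clY => V /nbhs_windowP[F FV].
  by have [y Yy yx] := Yx F; exists y; split=> //; apply: FV.
move=> Yx; apply: clY => F.
by have [y [Yy yx]] := Yx _ (nbhs_window x F); exists y.
Qed.

Lemma full_shift_compact : compact [set: full_shift G A].
Proof.
have := @tychonoff G (fun=> discrete_topology A) (fun=> setT).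
rewrite (_ : [set f | _] = setT); last by apply/seteqP; split.
by apply=> _; apply: finite_compact; apply: (@finite_finset A).
Qed.

Lemma closed_full_shift_compact Y : closed Y -> compact Y.
Proof. by move=> clY; apply: subclosed_compact full_shift_compact _. Qed.

Lemma compact_full_shift_closed Y : compact Y -> closed Y.
Proof.
apply: compact_closed.
apply: (@hausdorff_product G (fun=> discrete_topology A)).
by move=> _; apply: discrete_hausdorff.
Qed.

(** The Lebesgue number lemma of the compact space Y: a single window is fine
    enough for a neighbourhood assignment on all of Y. *)
Lemma uniform_window Y (N : full_shift G A -> set (full_shift G A)) :
  closed Y -> (forall y, Y y -> nbhs y (N y)) ->
  exists F : {fset G}, forall y, Y y ->
    exists2 y', Y y' & forall z, {in F, z =1 y} -> N y' z.
Proof.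
move=> /closed_full_shift_compact/compact_near_coveringP cptY nbN.
(* Windows ordered by inclusion; the condition below is monotone in F. *)
pose large := filter_from [set: {fset G}]
  (fun F0 => [set F | (F0 `<=` F)%fset]).
have large_filter : Filter large.
  apply: filter_from_filter; first by exists fset0.
  move=> F1 F2 _ _; exists (F1 `|` F2)%fset => // F.
  by rewrite /= fsubUset => /andP[].
pose fine (F : {fset G}) (y : full_shift G A) := exists2 y', Y y' &
  forall z : full_shift G A, {in F, z =1 y} -> N y' z.
have [y Yy|F0 _ F0fine] := cptY _ large fine large_filter; last first.
  by exists F0 => y; apply: F0fine => /=; apply: fsubset_refl.
have /nbhs_windowP[W WN] := nbN y Yy.
exists ([set w : full_shift G A | {in W, w =1 y}],
        [set F | (W `<=` F)%fset]) => /=.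
  by split; [apply: nbhs_window | exists W].
move=> [w F] /= [wy /fsubsetP WF]; exists y => // z zw.
by apply: WN => h hW; rewrite zw ?wy //; apply: WF.
Qed.

End FullShift.

(** * Orbit closures and hulls of finite type *)

Section Shifts.
Variables (G : groupType) (A : finType).
Implicit Types (x y z : full_shift G A) (X Y Z : set (full_shift G A)).

Lemma shift_actE g x h : shift_act g x h = x (g^-1 * h)%g.
Proof. by []. Qed.

Lemma shift_actM g h x : shift_act g (shift_act h x) = shift_act (g * h)%g x.
Proof. by apply/funext => k; rewrite !shift_actE invgM mulgA. Qed.

Lemma shift_act1 x : shift_act 1%g x = x.
Proof. by apply/funext => k; rewrite shift_actE invg1 mul1g. Qed.

Lemma shift_invariantP Y :
  shift_invariant Y <-> forall g y, Y y -> Y (shift_act g y).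
Proof.
by split=> Yinv g; [move=> y Yy; apply: (Yinv g); exists y
                   |move=> _ [y Yy <-]; apply: Yinv].
Qed.

Lemma sft_avoids (P : set {fmap G -> A}) x :
  (~` (\bigcup_(p in P) \bigcup_(g in [set: G]) (shift_act g @` cylinder p))) x
  <-> forall p, P p -> forall g, ~ cylinder p (shift_act g x).
Proof.
split=> [Px p Pp g px|Px [p Pp [g _ [y py yx]]]].
  apply: Px; exists p => //; exists g^-1%g => //; exists (shift_act g x) => //.
  by rewrite shift_actM mulVg shift_act1.
by apply: (Px p Pp g^-1%g); rewrite -yx shift_actM mulVg shift_act1.
Qed.

(** Phrased through windows rather than with [closure], because all arguments
    approximate its points by translates of z on a finite set. *)
Definition orbit_closure z : set (full_shift G A) :=
  [set x : full_shift G A |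
    forall F : {fset G}, exists g, {in F, x =1 shift_act g z}].

Lemma orbit_closure_shift z g : orbit_closure z (shift_act g z).
Proof. by move=> F; exists g. Qed.

Lemma orbit_closure_subshift z : is_subshift (orbit_closure z).
Proof.
split; first by exists (shift_act 1%g z); apply: orbit_closure_shift.
  apply/closed_windowP => x zx F; have [y zy yx] := zx F.
  by have [g yz] := zy F; exists g => h hF; rewrite -yx // yz.
apply/shift_invariantP => g x zx F.
have [k xz] := zx [fset (g^-1 * h)%g | h in F]%fset.
exists (g * k)%g => h hF; rewrite -shift_actM.
by apply: (xz (g^-1 * h)%g); rewrite in_imfset.
Qed.

Lemma orbit_closure_sub z Y : is_subshift Y -> Y z -> orbit_closure z `<=` Y.
Proof.
move=> [_ /closed_windowP clY /shift_invariantP Yinv] Yz x zx; apply: clY => F.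
by have [g xz] := zx F; exists (shift_act g z); [apply: Yinv | move=> h /xz].
Qed.

(** The smallest SFT with window F that contains the subshift Y. *)
Definition sft_hull (F : {fset G}) Y : set (full_shift G A) :=
  [set x : full_shift G A |
    forall g, exists2 y, Y y & forall h, h \in F -> x (g * h)%g = y h].

Lemma sub_sft_hull F Y : shift_invariant Y -> Y `<=` sft_hull F Y.
Proof.
move=> /shift_invariantP Yinv y Yy g; exists (shift_act g^-1%g y) => [|h _].
  exact: Yinv.
by rewrite shift_actE invgK.
Qed.

Lemma sft_hull_subshift F Y : is_subshift Y -> is_subshift (sft_hull F Y).
Proof.
move=> [[y Yy] _ Yinv]; split; first by exists y; apply: sub_sft_hull.
  apply/closed_windowP => x Yx g.
  have [y' Yy' y'x] := Yx [fset (g * h)%g | h in F]%fset.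
  have [w Yw y'w] := Yy' g; exists w => // h hF.
  by rewrite -y'w // y'x // in_imfset.
apply/shift_invariantP => g x Yx k; have [w Yw xw] := Yx (g^-1 * k)%g.
by exists w => // h hF; rewrite shift_actE mulgA xw.
Qed.

(** The forbidden patterns are the functions on F that no point of Y extends;
    they are finitely many because F and the alphabet are finite. *)
Lemma sft_hull_sft F Y : is_subshift Y -> is_sft (sft_hull F Y).
Proof.
move=> Ysub; split; first exact: sft_hull_subshift.
pose forbidden : set {ffun F -> A} :=
  [set q | forall y, Y y -> ~ forall h : F, y (val h) = q h].
exists [set FinMap q | q in forbidden].
  apply: finite_image; apply: finite_finset.
apply/seteqP; split=> x.
  move=> Yx; apply/sft_avoids => _ [q qY <-] g /= xq.
  have [y Yy xy] := Yx g^-1%g; apply: (qY y Yy) => h.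
  by rewrite -xy ?fsvalP // -shift_actE; apply: xq.
move=> /sft_avoids xP g; apply: contrapT => noy.
pose q : {ffun F -> A} := [ffun h => x (g * val h)%g].
apply: (xP (FinMap q) _ g^-1%g) => [|h].
  exists q => // y Yy yq; apply: noy; exists y => // h hF.
  by have := yq [` hF]%fset; rewrite ffunE.
by rewrite shift_actE invgK; apply/esym/ffunE.
Qed.

End Shifts.

(** * Block codes *)

(** The Curtis-Hedlund-Lyndon theorem: a factor map is a block code, reading
    through one finite window D around each site. Comparing two configurations at
    two different sites h and k makes equivariance part of the conclusion. *)
Lemma factor_map_block_code (G : groupType) (B A : finType)
    (Y : set (full_shift G B)) (X : set (full_shift G A))
    (f : full_shift G B -> full_shift G A) :
  is_subshift Y -> factor_map Y X f ->
  exists D : {fset G}, forall u v h k, Y u -> Y v ->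
    (forall d, d \in D -> u (h * d)%g = v (k * d)%g) -> f u h = f v k.
Proof.
move=> [_ clY /shift_invariantP Yinv] [fcont feq _].
pose N (y : full_shift G B) : set (full_shift G B) :=
  [set z | Y z -> f z 1%g = f y 1%g].
have [y Yy|D DN] := @uniform_window _ _ Y N clY.
  have /subspace_continuousP fc := fcont.
  pose V : set (full_shift G A) :=
    [set x : full_shift G A | {in [fset 1%g]%fset, x =1 f y}].
  have W : within Y (nbhs y) (f @^-1` V) := fc y Yy V (nbhs_window _ _).
  by move: W; apply: filterS => z; apply; rewrite in_fset1.
exists D => u v h k Yu Yv uv.
pose u' := shift_act h^-1%g u; pose v' := shift_act k^-1%g v.
have Yu' : Y u' by apply: Yinv.
have Yv' : Y v' by apply: Yinv.
have [y _ yN] := DN _ Yv'.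
have fE w g : Y w -> f w g = f (shift_act g^-1%g w) 1%g.
  by move=> Yw; rewrite feq // shift_actE invgK mulg1.
rewrite (fE u) // (fE v) // (yN u') ?(yN v') // => d dD.
by rewrite /u' /v' !shift_actE !invgK uv.
Qed.

(** * The Vietoris topology *)

Section Vietoris.
Variables (G : groupType) (A : finType).
Implicit Types (X Y Z : subshift G A).

Lemma vietoris_subbase_open (i : bool * set (full_shift G A)) :
  open i.2 -> open (vietoris_subbase i).
Proof.
move=> oi; exists [set vietoris_subbase i].
  move=> _ ->; exists [fset i]%fset.
    by move=> j /fset1P ->; apply/mem_set.
  apply/seteqP; split=> Y /=; first by apply; rewrite /= in_fset1.
  by move=> Yi j /fset1P->.
by apply/seteqP; split=> [Y [_ ->]|Y Yi] //; exists (vietoris_subbase i).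
Qed.

Lemma vietoris_subbaseP (U : set (subshift G A)) Y :
  open U -> U Y -> exists I : {fset bool * set (full_shift G A)},
    [/\ forall i, i \in I -> open i.2,
        forall i, i \in I -> vietoris_subbase i Y &
        forall Z, (forall i, i \in I -> vietoris_subbase i Z) -> U Z].
Proof.
move=> [UU UUfin <-] [V UV VY]; have [I Iopen VE] := UUfin V UV.
have {}VE : \bigcap_(i in [set` I]) vietoris_subbase i = V := VE.
exists I; split=> [i iI|i iI|Z ZI]; first exact: (set_mem (Iopen i iI)).
  by have : V Y := VY; rewrite -VE; apply.
by exists V => //; have : V Z by rewrite -VE => i; apply: ZI.
Qed.

(** Compactness turns containment in an open set into a condition on finitely
    many coordinates, so a Vietoris neighbourhood of Y contains all subshifts
    with the same F-patterns as Y, for some finite F. *)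
Lemma vietoris_window (U : set (subshift G A)) Y :
  open U -> U Y -> exists F : {fset G}, forall Z,
    (forall z, subshift_set Z z ->
      exists2 y, subshift_set Y y & {in F, z =1 y}) ->
    (forall y, subshift_set Y y ->
      exists2 z, subshift_set Z z & {in F, z =1 y}) -> U Z.
Proof.
move=> oU /(vietoris_subbaseP oU)[I [Iopen IY IU]].
suff [F FI] : exists F : {fset G}, forall Z,
    (forall z, subshift_set Z z ->
      exists2 y, subshift_set Y y & {in F, z =1 y}) ->
    (forall y, subshift_set Y y ->
      exists2 z, subshift_set Z z & {in F, z =1 y}) ->
    forall i, i \in I -> vietoris_subbase i Z.
  by exists F => Z ZY YZ; apply: IU; apply: FI.
have /choice[win winP] i : exists F : {fset G}, i \in I -> forall Z,
    (forall z, subshift_set Z z ->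
      exists2 y, subshift_set Y y & {in F, z =1 y}) ->
    (forall y, subshift_set Y y ->
      exists2 z, subshift_set Z z & {in F, z =1 y}) ->
    vietoris_subbase i Z.
  (* Containment in i.2 needs compactness of Y, meeting i.2 only one point. *)
  have [iI|] := boolP (i \in I); last by exists fset0.
  have oi := Iopen i iI; have := IY i iI.
  rewrite /vietoris_subbase; case: ifP => _ /= => [Yi|[y [Yy iy]]].
    have [_ clY _] := subshiftP Y.
    have [y Yy|F FP] := @uniform_window _ _ Y (fun=> i.2) clY.
      by move: (oi); rewrite openE; apply; apply: Yi.
    by exists F => _ Z ZY _ z /ZY[y /FP[_ _ yF]]; apply: yF.
  have /nbhs_windowP[F FP] : nbhs y i.2 by move: (oi); rewrite openE; apply.
  by exists F => _ Z _ YZ; have [z Zz /FP] := YZ y Yy; exists z.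
exists (\bigcup_(i <- I) win i)%fset => Z ZY YZ i iI.
apply: winP => // [z /ZY|y /YZ] [w ? zw]; exists w => // h hi; apply: zw;
  by apply/bigfcupP; exists i; rewrite ?iI.
Qed.

End Vietoris.

(** * Splicing along cosets of a subgroup *)

Section Splice.
Variable G : groupType.

(** The form in which the lack of finite generation is used: whatever finite
    amount of data a construction has consumed, a fresh coset remains. *)
Lemma proper_subgroup_of_finite (F : {fset G}) : ~ finitely_generated G ->
  exists (H : set G) (g : G),
    [/\ group_closed (fun x => x \in H), {subset F <= H} & g \notin H].
Proof.
move=> nfg; pose isgroup (K : set G) := group_closed (fun x => x \in K).
pose H := smallest isgroup [set` F].
have Hgroup : isgroup H.
  split; first by apply/mem_set => K [[K1 _] _]; apply: set_mem.
  move=> u v /set_mem Hu /set_mem Hv; apply/mem_set => K KF; apply: set_mem.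
  by have [[_ Kdiv] _] := KF; apply: Kdiv; apply/mem_set; [apply: Hu|apply: Hv].
have /existsNP[g gH] : ~ forall g, H g.
  move=> HT; apply: nfg; exists [set` F]; first exact: finite_fset.
  by apply/seteqP; split=> // g _; apply: HT.
exists H, g; split=> //; last by apply/negP => /set_mem.
by move=> h hF; apply/mem_set; apply: sub_gen_smallest.
Qed.

Definition splice (T : Type) (H : set G) (a b : G -> T) : G -> T :=
  fun h => if h \in H then a h else b h.

Variables (A : finType) (H : set G).
Hypothesis Hgroup : group_closed (fun x => x \in H).

Lemma mem_subgroupMr g h : h \in H -> ((g * h)%g \in H) = (g \in H).
Proof.
move=> hH; have := group_closedM Hgroup; have := group_closedV Hgroup => HV HM.
apply/idP/idP => [ghH|gH]; last exact: HM.
by rewrite -[g](mulgK h); apply: HM => //; apply: HV.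
Qed.

Lemma splice_in T (a b : G -> T) g h :
  g \in H -> h \in H -> splice H a b (g * h)%g = a (g * h)%g.
Proof. by move=> gH hH; rewrite /splice mem_subgroupMr // gH. Qed.

Lemma splice_out T (a b : G -> T) g h :
  g \notin H -> h \in H -> splice H a b (g * h)%g = b (g * h)%g.
Proof.
by move=> /negbTE gH hH; rewrite /splice mem_subgroupMr // gH.
Qed.

(** When the window lies in the subgroup H, each translate of it lies in a
    single left coset of H, so the constraints of the hull never relate
    different cosets. *)
Lemma splice_sft_hull (F : {fset G}) (Y : set (full_shift G A))
    (a b : full_shift G A) : {subset F <= H} ->
  sft_hull F Y a -> sft_hull F Y b -> sft_hull F Y (splice H a b).
Proof.
move=> FH Ya Yb g; have [gH|gH] := boolP (g \in H).
  have [y Yy ay] := Ya g; exists y => // h hF.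
  by rewrite splice_in // ?ay ?FH.
have [y Yy bY] := Yb g; exists y => // h hF.
by rewrite splice_out // ?bY ?FH.
Qed.

End Splice.

(** Splicing one pattern after the other, each into a fresh coset of a larger
    subgroup, yields a point of the hull that sees all F-patterns of Y at
    positions from one finite set T. *)
Lemma sft_hull_universal_point (G : groupType) (A : finType)
    (Y : set (full_shift G A)) (F : {fset G}) :
  ~ finitely_generated G -> is_subshift Y ->
  exists2 z, sft_hull F Y z & exists T : {fset G}, forall y, Y y ->
    exists2 g, g \in T & forall h, h \in F -> z (g * h)%g = y h.
Proof.
move=> nfg [[y0 Yy0] clY Yinv].
pose pat (y : full_shift G A) : {ffun F -> A} := [ffun h => y (val h)].
suff [z Yz [T zT]] : exists2 z, sft_hull F Y z & exists T : {fset G},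
    forall y, Y y -> pat y \in enum {ffun F -> A} ->
    exists2 g, g \in T & forall h, h \in F -> z (g * h)%g = y h.
  by exists z => //; exists T => y Yy; apply: zT; rewrite // mem_enum.
elim: (enum _) => [|q s [z Yz [T zT]]].
  by exists y0; [apply: sub_sft_hull | exists fset0].
have [[w Yw wq]|noq] := pselect (exists2 w, Y w & pat w = q); last first.
  exists z => //; exists T => y Yy; rewrite in_cons => /orP[/eqP yq|].
    by exfalso; apply: noq; exists y.
  exact: zT.
have [H [g [Hgroup FTH gH]]] := proper_subgroup_of_finite (F `|` T)%fset nfg.
have FH : {subset F <= H} by move=> h hF; apply: FTH; rewrite in_fsetE hF.
exists (splice H z (shift_act g w)).
  apply: splice_sft_hull => //; apply: sub_sft_hull => //.
  by move: Yinv => /shift_invariantP; apply.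
exists (g |` T)%fset => y Yy; rewrite in_cons => /orP[/eqP yq|ys].
  exists g => [|h hF]; first by rewrite fset1U1.
  rewrite (splice_out Hgroup) // ?FH // shift_actE mulgA mulVg mul1g.
  have := congr1 (fun p : {ffun F -> A} => p [` hF]%fset)
    (etrans wq (esym yq)).
  by rewrite !ffunE.
have [k kT zk] := zT y Yy ys; exists k => [|h hF].
  by rewrite in_fsetE kT orbT.
have kH : k \in H by apply: FTH; rewrite in_fsetE kT orbT.
by rewrite (splice_in Hgroup) ?zk // FH.
Qed.

(** * Projectively isolated subshifts are sofic and minimal *)

Section ProjectivelyIsolated.
Variables (G : groupType) (A B : finType).
Variables (X : subshift G A) (Phi : full_shift G B -> full_shift G A).
Variable U : set (subshift G B).
Hypotheses (PhiF : factor_map [set: full_shift G B] [set: full_shift G A] Phi)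
  (oU : open U) (UX : forall Y : subshift G B, U Y -> Phi @` Y = X).

Lemma sub_factor_map (Y : set (full_shift G B)) :
  Phi @` Y = X -> factor_map Y X Phi.
Proof.
have [Phic Phieq _] := PhiF; split=> //; last by move=> g y _; apply: Phieq.
by apply: continuous_subspaceW Phic.
Qed.

(** The hull has the same F-patterns as Y, hence lies in U; so does any of its
    subshifts that still shows all of these patterns. *)
Lemma isolated_sft_cover (Y : subshift G B) : U Y -> exists F : {fset G},
  Phi @` sft_hull F Y = X /\
  forall Z, is_subshift Z -> Z `<=` sft_hull F Y ->
    (forall y, subshift_set Y y -> exists2 z, Z z & {in F, z =1 y}) ->
    Phi @` Z = X.
Proof.
move=> UY; have [F FU] := vietoris_window oU UY; exists F.
have ZX Z : is_subshift Z -> Z `<=` sft_hull F Y ->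
    (forall y, subshift_set Y y -> exists2 z, Z z & {in F, z =1 y}) ->
    Phi @` Z = X.
  move=> Zsub ZY YZ; apply: (UX (Y := Subshift Zsub)); apply: FU => // z /ZY zY.
  by have [y Yy zy] := zY 1%g; exists y => // h hF; rewrite -zy // mul1g.
split=> //; apply: ZX => //; first exact: sft_hull_subshift (subshiftP Y).
move=> y Yy; exists y => //; apply: sub_sft_hull => //.
by have [] := subshiftP Y.
Qed.

Lemma isolated_sofic : (0 < #|B|)%N -> U !=set0 -> is_sofic X.
Proof.
move=> B0 [Y /isolated_sft_cover[F [FX _]]]; split; first exact: subshiftP.
exists B, (sft_hull F Y), Phi; split=> //; last exact: sub_factor_map.
exact: sft_hull_sft (subshiftP Y).
Qed.

(** Every pattern x'|K of X has to be found in a given point x of a subsystem.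
    In the orbit closure of z1, a pattern could come from the part of z1 on H,
    which has nothing to do with x; asking for the pattern in two cosets of H at
    once rules this out for one of the occurrences. *)
Lemma isolated_minimal : ~ finitely_generated G -> U !=set0 -> is_minimal X.
Proof.
move=> nfg [Y UY]; split; first exact: subshiftP.
move=> X' X'X [x X'x] /closed_windowP clX' /shift_invariantP X'inv.
have [F [FX FZ]] := isolated_sft_cover UY.
have Ysub := subshiftP Y; have hullsub := sft_hull_subshift F Ysub.
have [z Yz [T zT]] := sft_hull_universal_point F nfg Ysub.
have [D PhiD] : exists D : {fset G}, forall u v h k,
    (forall d, d \in D -> u (h * d)%g = v (k * d)%g) -> Phi u h = Phi v k.
  have Tsub : is_subshift [set: full_shift G B].
    by split=> //; exists z.
  have [D PhiD] := factor_map_block_code Tsub PhiF.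
  by exists D => u v h k; apply: PhiD.
apply/seteqP; split=> // x' Xx'; apply: clX' => K.
have [y Yy yx] : (Phi @` sft_hull F Y) x by rewrite FX; apply: X'X.
have [y' Yy' yx'] : (Phi @` sft_hull F Y) x' by rewrite FX.
have [H [g [Hgroup FH gH]]] :=
  proper_subgroup_of_finite (F `|` T `|` D `|` K)%fset nfg.
have HM := group_closedM Hgroup; have HV := group_closedV Hgroup.
have [FsubH TsubH DsubH KsubH] : [/\ {subset F <= H}, {subset T <= H},
    {subset D <= H} & {subset K <= H}].
  by split=> h hS; apply: FH; rewrite !in_fsetE hS ?orbT.
(* z1 shows every F-pattern of Y, but its image is that of y off H. *)
pose z1 : full_shift G B := splice H z y.
have Yz1 : sft_hull F Y z1 by apply: splice_sft_hull.
have z1X : Phi @` orbit_closure z1 = X.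
  apply: FZ; first exact: orbit_closure_subshift.
    exact: orbit_closure_sub.
  move=> w /zT[k kT zk]; exists (shift_act k^-1%g z1) => [|h hF].
    exact: orbit_closure_shift.
  by rewrite /z1 shift_actE invgK (splice_in Hgroup) ?zk ?(TsubH k) ?(FsubH h).
have Phiz1 h : h \notin H -> Phi z1 h = x h.
  move=> hH; rewrite -yx; apply: PhiD => d dD.
  by rewrite /z1 (splice_out Hgroup) ?(DsubH d).
(* z2 shows the pattern of x' on K in two distinct cosets of H. *)
pose z2 : full_shift G B := splice H y' (shift_act g y').
have Yz2 : sft_hull F Y z2.
  apply: splice_sft_hull => //; have [_ _ /shift_invariantP hullinv] := hullsub.
  exact: hullinv.
have Phiz2K k : k \in K -> Phi z2 k = x' k.
  move=> kK; rewrite -yx'; apply: PhiD => d dD.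
  by rewrite /z2 (splice_in Hgroup) ?(DsubH d) ?(KsubH k).
have Phiz2gK k : k \in K -> Phi z2 (g * k)%g = x' k.
  move=> kK; rewrite -yx'; apply: PhiD => d dD.
  rewrite /z2 (splice_out Hgroup) ?(DsubH d) //; last first.
    by rewrite (mem_subgroupMr Hgroup) ?(KsubH k).
  by rewrite shift_actE !mulgA mulVg mul1g.
have [u z1u uz2] : (Phi @` orbit_closure z1) (Phi z2).
  by rewrite z1X -FX; exists z2.
pose KgK := (K `|` [fset (g * k)%g | k in K])%fset.
have [t uz1] := z1u [fset (k * d)%g | k in KgK, d in D]%fset.
have Phiz2z1 k : k \in KgK -> Phi z2 k = Phi z1 (t^-1 * k)%g.
  move=> kK; rewrite -uz2; apply: PhiD => d dD.
  by rewrite uz1 ?shift_actE ?mulgA // in_imfset2.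
(* t^-1 and t^-1 g cannot both lie in H, since g does not. *)
have [s [sH sK]] : exists s, s \notin H /\
    forall k, k \in K -> x' k = Phi z1 (s * k)%g.
  have [tH|tH] := boolP (t^-1%g \in H); last first.
    exists t^-1%g; split=> // k kK.
    by rewrite -Phiz2K // Phiz2z1 // in_fsetE kK.
  exists (t^-1 * g)%g; split=> [|k kK].
    apply: contra gH => tgH; rewrite -[g](mulKg t^-1%g); apply: HM => //.
    exact: HV.
  by rewrite -Phiz2gK // Phiz2z1 ?mulgA // !in_fsetE in_imfset ?orbT.
exists (shift_act s^-1%g x) => [|k kK]; first exact: X'inv.
by rewrite sK // shift_actE invgK Phiz1 // (mem_subgroupMr Hgroup) ?(KsubH k).
Qed.

End ProjectivelyIsolated.

(** * Minimal sofic subshifts are projectively isolated *)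

Lemma block_code_continuous (G : groupType) (B A : finType)
    (f : full_shift G B -> full_shift G A) (D : {fset G}) :
  (forall u v h, (forall d, d \in D -> u (h * d)%g = v (h * d)%g) ->
     f u h = f v h) -> continuous f.
Proof.
move=> fD u V /nbhs_windowP[F FV]; apply/nbhs_windowP.
exists [fset (h * d)%g | h in F, d in D]%fset => v vu.
by apply: FV => h hF; apply: fD => d dD; apply: vu; rewrite in_imfset2.
Qed.

Lemma factor_image_subshift (G : groupType) (B A : finType)
    (Y : set (full_shift G B)) (f : full_shift G B -> full_shift G A) :
  is_subshift Y -> factor_map Y (f @` Y) f -> is_subshift (f @` Y).
Proof.
move=> [[y Yy] clY /shift_invariantP Yinv] [fc feq _]; split.
- by exists (f y); exists y.
- apply: compact_full_shift_closed; apply: continuous_compact => //.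
  exact: closed_full_shift_compact.
- apply/shift_invariantP => g _ [w Yw <-].
  by exists (shift_act g w); [apply: Yinv | apply: feq].
Qed.

Section MinimalSofic.
Variables (G : groupType) (A C : finType).
Variables (X : subshift G A) (Y : set (full_shift G C)).
Variable f : full_shift G C -> full_shift G A.
Hypotheses (fF : factor_map Y X f) (Ysft : is_sft Y).
Variables (a0 : A) (c0 : C).

Local Notation B := (C + A)%type.

Definition embed_left (w : full_shift G C) : full_shift G B :=
  fun h => inl (w h).

Definition left_part (z : full_shift G B) : full_shift G C :=
  fun h => if z h is inl c then c else c0.

Lemma embed_left_subshift : is_subshift (embed_left @` Y).
Proof.
have [[[y Yy] /closed_windowP clY /shift_invariantP Yinv] _] := Ysft; split.
- by exists (embed_left y); exists y.
- apply/closed_windowP => z zY; exists (left_part z).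
    apply: clY => F; have [_ [w Yw <-] wz] := zY F.
    by exists w => // h hF; rewrite /left_part -wz.
  apply/funext => h; have [_ [w _ <-] wz] := zY [fset h]%fset.
  by rewrite /embed_left /left_part -wz ?in_fset1.
- apply/shift_invariantP => g _ [w Yw <-].
  by exists (shift_act g w); first exact: Yinv.
Qed.

(** The forbidden patterns of Y are finitely many, so a finite window suffices
    to recognize the subshifts of the copy of Y over the larger alphabet. *)
Lemma embed_left_window : exists W : {fset G}, forall Z : set (full_shift G B),
  shift_invariant Z ->
  (forall z, Z z -> exists2 y, Y y & {in W, z =1 embed_left y}) ->
  Z `<=` embed_left @` Y.
Proof.
have [_ [P Pfin YE]] := Ysft.
(* The site 1 makes the window see that all symbols are in C. *)
exists (1%g |` \bigcup_(p <- fset_set P) domf p)%fset.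
move=> Z /shift_invariantP Zinv ZY z Zz.
have zE : z = embed_left (left_part z).
  apply/funext => h; have [y _ zy] := ZY _ (Zinv h^-1%g z Zz).
  have := zy 1%g; rewrite fset1U1 shift_actE invgK mulg1 => /(_ isT).
  by rewrite /embed_left /left_part => ->.
exists (left_part z) => //; rewrite YE; apply/sft_avoids => p Pp g pz.
have [y Yy zy] := ZY _ (Zinv g z Zz).
move: (Yy); rewrite YE => /sft_avoids/(_ p Pp 1%g); apply => h.
rewrite shift_act1 -pz shift_actE; apply: (@inl_inj C A).
have hW : val h \in (1%g |` \bigcup_(p <- fset_set P) domf p)%fset.
  rewrite in_fsetE; apply/orP; right; apply/bigfcupP; exists p.
    by rewrite in_fset_set // andbT mem_set.
  exact: fsvalP.
by have := zy _ hW; rewrite shift_actE zE => /esym.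
Qed.

(** An extension of f to a factor map onto the full shift over A: symbols of A
    are copied, symbols of C are read through the block code of f. *)
Lemma factor_extension : exists Phi : full_shift G B -> full_shift G A,
  factor_map [set: full_shift G B] [set: full_shift G A] Phi /\
  forall y, Y y -> Phi (embed_left y) = f y.
Proof.
have [Ysub _] := Ysft; have [D fD] := factor_map_block_code Ysub fF.
pose rule (w : full_shift G C) : A :=
  xget a0 [set a | exists2 y, Y y & {in D, w =1 y} /\ f y 1%g = a].
have ruleD v w : {in D, v =1 w} -> rule v = rule w.
  move=> vw; congr xget; apply/seteqP; split=> a [y Yy [vy fa]];
    by exists y => //; split=> // d dD; rewrite -vy ?vw.
have ruleE y : Y y -> rule y = f y 1%g.
  move=> Yy; apply: xget_unique; first by exists y.
  move=> a [w Yw [yw <-]]; apply: fD => // d dD.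
  by rewrite mul1g yw.
pose Phi (z : full_shift G B) : full_shift G A :=
  fun h => if z h is inr a then a else rule (left_part (shift_act h^-1%g z)).
exists Phi; split; last first.
  move=> y Yy; apply/funext => h.
  have -> : Phi (embed_left y) h = rule (shift_act h^-1%g y) by [].
  have [_ _ /shift_invariantP Yinv] := Ysub.
  have [_ feq _] := fF.
  by rewrite ruleE ?feq // ?shift_actE ?invgK ?mulg1 //; apply: Yinv.
split.
- apply: continuous_subspaceT.
  apply: (@block_code_continuous _ _ _ _ (1%g |` D)%fset).
  move=> u v h uv; rewrite /Phi.
  have -> : u h = v h by have := uv 1%g; rewrite fset1U1 mulg1; apply.
  case: (v h) => // _; apply: ruleD => d dD.
  by rewrite /left_part !shift_actE invgK uv // in_fsetE dD orbT.
- move=> g z _; apply/funext => h; rewrite shift_actE /Phi shift_actE.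
  by rewrite shift_actM invgM invgK.
- apply/seteqP; split=> // x _.
  by exists (fun h => inr (x h)).
Qed.

Lemma minimal_sft_factor_isolated : is_minimal X -> projectively_isolated X.
Proof.
move=> [_ Xmin]; have [Phi [PhiF PhiE]] := factor_extension.
have [W WY] := embed_left_window.
have [_ _ fY] := fF.
pose O : set (full_shift G B) :=
  [set z : full_shift G B | exists2 y, Y y & {in W, z =1 embed_left y}].
have oO : open O.
  rewrite openE => z [y Yy zy]; apply/nbhs_windowP; exists W => w wz.
  by exists y => // h hW; rewrite wz // zy.
exists (C + A)%type, Phi, (vietoris_subbase (true, O)); split=> //.
- by rewrite card_sum addn_gt0; apply/orP; left; apply/card_gt0P; exists c0.
- exact: vietoris_subbase_open.
- by exists (Subshift embed_left_subshift) => _ [y Yy <-]; exists y.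
move=> Z ZO; have Zsub := subshiftP Z.
have ZY : Z `<=` embed_left @` Y by apply: WY ZO; have [] := Zsub.
have [[z Zz] clZ Zinv] := Zsub.
have [|[x Zx] clPhi Phiinv] := @factor_image_subshift _ _ _ Z Phi Zsub.
  have [Phic Phieq _] := PhiF; split=> //; last by move=> g w _; apply: Phieq.
  exact: continuous_subspaceW Phic.
apply: Xmin => //; last by exists x.
by move=> _ [w /ZY[y Yy <-] <-]; rewrite PhiE // -fY; exists y.
Qed.

End MinimalSofic.

Theorem theorem1p7 (G : groupType) (A : finType) (X : subshift G A)
    (G_countable : countable [set: G])
    (G_not_fg : ~ finitely_generated G)
    (A_nonempty : (0 < #|A|)%N) :
  projectively_isolated X <-> is_minimal X /\ is_sofic X.
Proof.
split=> [[B [Phi [U [B0 PhiF oU U0 UX]]]]|[Xmin [_ [C [Y [f [C0 Ysft fF]]]]]]].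
  split; first exact: (isolated_minimal PhiF oU UX).
  exact: (isolated_sofic PhiF oU UX).
have /card_gt0P[a0 _] := A_nonempty; have /card_gt0P[c0 _] := C0.
exact: (minimal_sft_factor_isolated fF Ysft a0 c0).
Qed.
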